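(* Let $H$ be a stable $n$-th order LTI model in diagonal canonical form $H(s)=D+\sum_{i=1}^n\frac{\Phi_i}{s-\lambda_i}$, let $0<r<n$ and $\tau>0$. For $\alpha\in\{0,1\}^n$ and $D_\alpha\in\mathbb{R}^{n_y\times n_u}$ let $H_\alpha(s)=D_\alpha+\sum_{i=1}^n\alpha_i\frac{\Phi_i}{s-\lambda_i}$, and let $e_\alpha=\mathcal{L}^{-1}(H-H_\alpha)$ be the impulse response of the error. Consider the $r$-th order optimal $h_{2,\tau}$ modal truncation problem $$\min_{\alpha,D_\alpha}\ \Vert e_\alpha\Vert_{2,\tau}\quad\text{s.t.}\quad\alpha\in\{0,1\}^n,\ D_\alpha\in\mathbb{R}^{n_y\times n_u},\ \mathds{1}^T\alpha=r,\ M\alpha=0 .$$ Then its solution $H_\alpha^\star$ is such that $D_\alpha^\star=D$ and $\alpha^\star$ is a solution of the problem $$\min_{\alpha}\ (\mathds{1}-\alpha)^TQ_\tau(\mathds{1}-\alpha)\quad\text{s.t.}\quad\alpha\in\{0,1\}^n,\ \mathds{1}^T\alpha=r,\ M\alpha=0,$$ where $Q_\tau\in\mathbb{C}^{n\times n}$ is the Hermitian matrix with entries $$[Q_\tau]_{i,j}=\left(1-e^{(\lambda_i+\lambda_j^* )\tau}\right)\frac{\mathrm{tr}(\Phi_i\Phi_j^H)}{-\lambda_i-\lambda_j^*},\qquad i,j=1,\ldots,n,$$ and the latter problem is a convex quadratic binary problem.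
   Context: Setting. $H$ is the LTI model $\dot x=Ax+Bu$, $y=Cx+Du$ with real matrices $A\in\mathbb{R}^{n\times n}$, $B\in\mathbb{R}^{n\times n_u}$, $C\in\mathbb{R}^{n_y\times n}$, $D\in\mathbb{R}^{n_y\times n_u}$, identified with its transfer function $H(s)=C(sI-A)^{-1}B+D$. It is stable (all eigenvalues of $A$ have negative real part) and $A$ has semi-simple eigenvalues $\lambda_1,\dots,\lambda_n$ (listed with multiplicity). With $AX=X\Delta$, $\Delta=\mathrm{diag}(\lambda_1,\dots,\lambda_n)$, $X$ invertible, $B_\Delta=X^{-1}B$, $C_\Delta=CX$, the residues are $\Phi_i=C_\Delta e_ie_i^TB_\Delta\in\mathbb{C}^{n_y\times n_u}$, which gives the diagonal canonical form. Conjugate pairs. The eigenvectors are chosen so that the non-real poles are grouped into $n_c$ disjoint pairs of indices $\{i,j\}$ with $\mathrm{Im}(\lambda_i)>0$, $\lambda_j=\lambda_i^*$ and $\Phi_j=\Phi_i^*$, and so that $\Phi_i$ is real when $\lambda_i$ is real. $\mathcal{I}^C$ is the set of these pairs. $M\in\mathbb{R}^{n_c\times n}$ has one row per pair $\{i,j\}\in\mathcal{I}^C$, with entry $1$ in column $i$, $-1$ in column $j$ and $0$ elsewhere; thus $M\alpha=0$ means $\alpha_i=\alpha_j$ for every pair. Notation. $\mathds{1}\in\mathbb{R}^n$ is the all-ones vector; $^*$ is (entrywise) complex conjugation, $^T$ transpose, $^H$ conjugate transpose, $\Vert\cdot\Vert_F$ the Frobenius norm. Norm. The impulse response of a model $G(s)=\sum_i\frac{\Psi_i}{s-\lambda_i}+D_G$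 is $g=\mathcal{L}^{-1}(G)$, $g(t)=\sum_i\Psi_ie^{\lambda_it}+D_G\delta(t)$ for $t\ge0$, with $\delta$ the Dirac impulse. For $G$ stable and strictly proper ($D_G=0$), $\Vert g\Vert_{2,\tau}^2=\int_0^\tau\Vert g(t)\Vert_F^2\,dt$; if $D_G\neq0$ the norm is regarded as $+\infty$ (the norm is only defined for strictly proper models). ''Convex quadratic binary problem'' means: binary variables, affine constraints, and a quadratic objective that is convex in the continuous relaxation. *)

(* Defs.v *)
From HB Require Import structures.
From mathcomp Require Import all_boot all_order all_algebra.
From mathcomp Require Import all_classical all_reals all_analysis.
From mathcomp Require Import complex.

Set Implicit Arguments.
Unset Strict Implicit.
Unset Printing Implicit Defensive.

Import Order.TTheory GRing.Theory Num.Theory.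
Import numFieldNormedType.Exports.

Local Open Scope classical_set_scope.
Local Open Scope ring_scope.
Local Open Scope sesquilinear_scope.

Notation toC := (real_complex _) (only parsing).

Section Complex.
Variable R : realType.

Definition cexp (z : R[i]) : R[i] :=
  toC (expR (complex.Re z)) * Complex (cos (complex.Im z)) (sin (complex.Im z)).

(* |z|^2 is a nonnegative real element of R[i]; its real part is the same
   number in R. *)
Definition frobenius m n (A : 'M[R[i]]_(m, n)) : R :=
  Num.sqrt (\sum_i \sum_j complex.Re (`|A i j| ^+ 2)).

End Complex.

Section DiagonalForm.
Variables (R : realType) (n nu ny : nat).

Definition stable (A : 'M[R]_n) : Prop :=
  forall z : R[i], eigenvalue (map_mx toC A) z -> 'Re z < 0.

Definition diagonalized_by (A : 'M[R]_n) (X : 'M[R[i]]_n) (lam : 'rV[R[i]]_n)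
    : Prop :=
  X \in unitmx /\ map_mx toC A *m X = X *m diag_mx lam.

Definition residue (B : 'M[R]_(n, nu)) (C : 'M[R]_(ny, n)) (X : 'M[R[i]]_n)
    (i : 'I_n) : 'M[R[i]]_(ny, nu) :=
  let B_Delta := invmx X *m map_mx toC B in
  let C_Delta := map_mx toC C *m X in
  let e_i : 'cV[R[i]]_n := delta_mx i 0 in
  C_Delta *m e_i *m e_i^T *m B_Delta.

Definition pair_set (nc : nat) (p : 'I_nc -> 'I_n * 'I_n) (k : 'I_nc)
    : {set 'I_n} := [set (p k).1; (p k).2]%SET.

(* The index pairs {i, j}, i = (p k).1, j = (p k).2, are listed by k < nc; the
   sign condition on 'Im lambda_i fixes the order inside a pair. *)
Record conjugate_pairing (lam : 'rV[R[i]]_n)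
    (Phi : 'I_n -> 'M[R[i]]_(ny, nu)) (nc : nat) (p : 'I_nc -> 'I_n * 'I_n)
    : Prop := ConjugatePairing {
  pairing_im_gt0 : forall k, 0 < 'Im (lam 0 (p k).1);
  pairing_pole : forall k, lam 0 (p k).2 = (lam 0 (p k).1)^*;
  pairing_residue : forall k, Phi (p k).2 = map_mx Num.conj (Phi (p k).1);
  pairing_disjoint : forall k l i,
    i \in pair_set p k -> i \in pair_set p l -> k = l;
  pairing_cover : forall i, lam 0 i \isn't Num.real ->
    exists k, i \in pair_set p k;
  pairing_real : forall i, lam 0 i \is Num.real -> Phi i \is a mxOver Num.real
}.

Definition pairing_mx (nc : nat) (p : 'I_nc -> 'I_n * 'I_n) : 'M[R]_(nc, n) :=
  \matrix_(k, l) ((l == (p k).1)%:R - (l == (p k).2)%:R).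

End DiagonalForm.

Section Models.
Variables (R : realType) (n nu ny : nat).

(* Models over a common list of poles lam : 'rV[R[i]]_n. *)
Record pole_residue := PoleResidue {
  residues : 'I_n -> 'M[R[i]]_(ny, nu);
  feedthrough : 'M[R]_(ny, nu)
}.

Definition transfer (lam : 'rV[R[i]]_n) (G : pole_residue) (s : R[i])
    : 'M[R[i]]_(ny, nu) :=
  map_mx toC (feedthrough G) + \sum_i (s - lam 0 i)^-1 *: residues G i.

Definition pr_sub (G1 G2 : pole_residue) : pole_residue :=
  PoleResidue (fun i => residues G1 i - residues G2 i)
              (feedthrough G1 - feedthrough G2).

Definition truncated (Phi : 'I_n -> 'M[R[i]]_(ny, nu)) (a : 'cV[R]_n)
    (D : 'M[R]_(ny, nu)) : pole_residue :=
  PoleResidue (fun i => toC (a i 0) *: Phi i) D.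

(* g(t) = regular g t + dirac g * delta(t), t >= 0. *)
Record response := Response {
  regular : R -> 'M[R[i]]_(ny, nu);
  dirac_part : 'M[R]_(ny, nu)
}.

(* Termwise inverse Laplace transform of transfer lam G. *)
Definition impulse_response (lam : 'rV[R[i]]_n) (G : pole_residue) : response :=
  Response (fun t => \sum_i cexp (lam 0 i * toC t) *: residues G i)
           (feedthrough G).

(* A response with a Dirac part (not strictly proper) has infinite norm. *)
Definition h2_norm (tau : R) (g : response) : \bar R :=
  if dirac_part g == 0 then
    sqrte (\int[lebesgue_measure]_(t in `[0%R, tau])
             (frobenius (regular g t) ^+ 2)%:E)%E
  else +oo%E.

Lemma transfer_sub lam G1 G2 s :
  transfer lam (pr_sub G1 G2) s = transfer lam G1 s - transfer lam G2 s.
Proof.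
rewrite /transfer /= map_mxB opprD addrACA; congr (_ + _).
by rewrite -sumrB; apply: eq_bigr => i _; rewrite scalerBr.
Qed.

(* The diagonal canonical form of D + C (sI - A)^-1 B. *)
Lemma transferE (A : 'M[R]_n) (B : 'M[R]_(n, nu)) (C : 'M[R]_(ny, n))
    (D : 'M[R]_(ny, nu)) (X : 'M[R[i]]_n) (lam : 'rV[R[i]]_n) (s : R[i]) :
  diagonalized_by A X lam -> (forall i, s != lam 0 i) ->
  map_mx toC C *m invmx (s%:M - map_mx toC A) *m map_mx toC B + map_mx toC D
  = transfer lam (PoleResidue (residue B C X) D) s.
Proof.
move=> [Xu AX] sl; rewrite addrC /transfer /=; congr (_ + _).
pose d : 'rV[R[i]]_n := \row_i (s - lam 0 i)^-1.
have AE : map_mx toC A = X *m diag_mx lam *m invmx X.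
  by rewrite -AX -mulmxA mulmxV // mulmx1.
have sE : s%:M - map_mx toC A = X *m diag_mx (const_mx s - lam) *m invmx X.
  rewrite AE linearB /= diag_const_mx mulmxBr mulmxBl; congr (_ - _).
  by rewrite mul_mx_scalar -scalemxAl mulmxV // scalemx1.
have dd : diag_mx (const_mx s - lam) *m diag_mx d = 1%:M.
  apply/matrixP => i j; rewrite mul_diag_mx !mxE.
  case: eqP => [->|_]; last by rewrite mulr0n mulr0.
  by rewrite mulr1n mulfV // subr_eq0.
have iE : invmx (s%:M - map_mx toC A) = X *m diag_mx d *m invmx X.
  have h : (s%:M - map_mx toC A) *m (X *m diag_mx d *m invmx X) = 1%:M.
    rewrite sE !mulmxA -(mulmxA _ (invmx X) X) mulVmx // mulmx1.
    by rewrite -(mulmxA X) dd mulmx1 mulmxV.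
  have [hu _] := mulmx1_unit h.
  by rewrite -[LHS]mulmx1 -h mulKmx.
have dE : diag_mx d =
    \sum_i (s - lam 0 i)^-1 *: (delta_mx i 0 *m (delta_mx i 0 : 'cV_n)^T).
  rewrite diag_mx_sum_delta; apply: eq_bigr => i _.
  by rewrite trmx_delta mul_delta_mx mxE.
rewrite iE dE mulmx_sumr mulmx_suml mulmx_sumr mulmx_suml.
apply: eq_bigr => i _; rewrite /residue !mulmxA.
by rewrite -scalemxAr -!(scalemxAl, scalemxAr) !mulmxA.
Qed.

End Models.

Section Problems.
Variable R : realType.

Definition minimizer d (T : Type) (U : porderType d) (S : set T) (f : T -> U)
    (x : T) : Prop :=
  S x /\ forall y, S y -> (f x <= f y)%O.

Definition binary n : set 'cV[R]_n := [set a | forall i, a i 0 \in [:: 0; 1]].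

Definition ones n : 'cV[R]_n := const_mx 1.

Definition modal_constraints n nc (r : nat) (M : 'M[R]_(nc, n))
    : set 'cV[R]_n :=
  [set a | [/\ binary a, (ones n)^T *m a = (r%:R)%:M & M *m a = 0]].

Definition truncation_feasible n nu ny nc (r : nat) (M : 'M[R]_(nc, n))
    : set ('cV[R]_n * 'M[R]_(ny, nu)) :=
  [set x | modal_constraints r M x.1].

Definition truncation_error n nu ny (lam : 'rV[R[i]]_n)
    (H : pole_residue R n nu ny) (tau : R) (x : 'cV[R]_n * 'M[R]_(ny, nu))
    : \bar R :=
  h2_norm tau
    (impulse_response lam (pr_sub H (truncated (residues H) x.1 x.2))).

Definition Q_mx n nu ny (lam : 'rV[R[i]]_n) (Phi : 'I_n -> 'M[R[i]]_(ny, nu))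
    (tau : R) : 'M[R[i]]_n :=
  \matrix_(i, j)
    ((1 - cexp ((lam 0 i + (lam 0 j)^*) * toC tau)) *
     (\tr (Phi i *m (Phi j) ^t*) / (- lam 0 i - (lam 0 j)^*))).

(* Values lie in R[i], whose order x <= y means Im x = Im y and Re x <= Re y. *)
Definition binary_objective n (Q : 'M[R[i]]_n) (a : 'cV[R]_n) : R[i] :=
  let b := map_mx toC (ones n - a) in (b^T *m Q *m b) 0 0.

Definition quadratic n (P : 'M[R]_n) (q : 'cV[R]_n) (c : R) (a : 'cV[R]_n) : R :=
  (a^T *m P *m a) 0 0 + (q^T *m a) 0 0 + c.

(* The continuous relaxation lets the variable range over real vectors, on all
   of which the objective must be a convex, real-valued quadratic.  Only affine
   equalities are allowed: with inequalities every set of binary vectors would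
   qualify. *)
Definition convex_quadratic_binary_problem n (S : set 'cV[R]_n)
    (f : 'cV[R]_n -> R[i]) : Prop :=
  (exists (m : nat) (E : 'M[R]_(m, n)) (b : 'cV[R]_m),
      S = [set a | binary a /\ E *m a = b]) /\
  (exists (P : 'M[R]_n) (q : 'cV[R]_n) (c : R),
      (forall a, f a = toC (quadratic P q c a)) /\
      convex_function (setT : set (convex_lmodType 'cV[R]_n))
        (quadratic P q c)).

End Problems.

(* Main.v *)
Require Import Defs.
From HB Require Import structures.
From mathcomp Require Import all_boot all_order all_algebra.
From mathcomp Require Import all_classical all_reals all_analysis.
From mathcomp Require Import complex.
From mathcomp Require Import ring.

(* With b = 1 - alpha, the error response is sum_i b_i Phi_i e^(lambda_i t)
   plus a Dirac impulse weighted by D - D_alpha; the impulse must vanish for the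
   norm to be finite.  The squared Frobenius norm expands into
   sum_(i, j) b_i b_j tr(Phi_i Phi_j^H) e^((lambda_i + lambda_j^* ) t), whose
   integral over [0, tau] is b^T Q b for every real b, binary or not.  This
   yields the equivalence of the two problems and, since the integral is
   nonnegative, the convexity of the relaxation. *)

Set Implicit Arguments.
Unset Strict Implicit.
Unset Printing Implicit Defensive.

Import Order.TTheory GRing.Theory Num.Theory.
Import numFieldNormedType.Exports.
Local Open Scope ring_scope.
Local Open Scope sesquilinear_scope.

(** * The complex exponential, its integral over an interval, and the Frobenius norm as a trace *)

Section Complex.
Variable R : realType.
Implicit Types (z w : R[i]) (t : R).

Lemma cexpE z : cexp z =
  Complex (expR (complex.Re z) * cos (complex.Im z))
          (expR (complex.Re z) * sin (complex.Im z)).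
Proof. by rewrite /cexp; simpc. Qed.

Lemma cexp0 : cexp (0 : R[i]) = 1.
Proof. by rewrite cexpE /= expR0 cos0 sin0 mulr1 mulr0. Qed.

Lemma cexpD z w : cexp (z + w) = cexp z * cexp w.
Proof.
rewrite !cexpE; case: z w => [a b] [c d] /=; simpc; rewrite expRD cosD sinD.
by congr Complex; ring.
Qed.

Lemma cexp_conj z : cexp z^* = (cexp z)^*.
Proof. by rewrite !cexpE; case: z => a b /=; rewrite cosN sinN mulrN. Qed.

(** Working with real parts keeps the functions real-valued, so that the real fundamental theorem of
    calculus applies. The factor [k] stays inside the real part because taking real parts is not
    multiplicative. *)
Lemma is_derive_Re_cexp (k m : R[i]) t :
  is_derive t 1 (fun x : R => complex.Re (k * cexp (m * real_complex R x)) : R)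
    (complex.Re (k * m * cexp (m * real_complex R t))).
Proof.
case: k m => [a b] [c d].
have E x : complex.Re (Complex a b * cexp (Complex c d * real_complex R x)) =
  a * (expR (c * x) * cos (d * x)) - b * (expR (c * x) * sin (d * x)).
  by rewrite cexpE /= !mulr0 subr0 add0r.
under eq_fun do rewrite E.
apply: is_derive_eq.
rewrite cexpE /= !mulr0 subr0 add0r /GRing.scale /=.
ring.
Qed.

Lemma integral_Re_cexp (I : finType) (k m : I -> R[i]) (tau : R) :
  0 < tau -> (forall i, m i != 0) ->
  (\int[lebesgue_measure]_(t in `[0%R, tau])
     (complex.Re (\sum_i k i * cexp (m i * real_complex R t)))%:E)%E =
  (complex.Re (\sum_i k i / m i * (cexp (m i * real_complex R tau) - 1)))%:E.
Proof.
move=> tau0 m0.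
pose G c x : R := complex.Re (\sum_i c i * cexp (m i * real_complex R x)).
have dG c t : is_derive t 1 (G c) (G (fun i => c i * m i) t).
  rewrite (_ : G c = \sum_i
      (fun x => complex.Re (c i * cexp (m i * real_complex R x)))); last first.
    by apply/funext => x; rewrite /G raddf_sum fct_sumE.
  rewrite /G raddf_sum.
  apply: (big_ind2 (fun (f : R -> R) (d : R) => is_derive t 1 f d)).
  - exact: is_derive_cst.
  - by move=> f a g b fa gb; exact: is_deriveD.
  - by move=> i _; exact: is_derive_Re_cexp.
have cG c : continuous (G c).
  move=> x; apply: differentiable_continuous; apply/derivable1_diffP.
  by have [] := dG c x.
(* Differentiating [G c] multiplies each [c i] by [m i], so dividing by the nonzero [m i] gives an
   antiderivative of [G k]. *)
pose F := G (fun i => k i / m i).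
rewrite (@continuous_FTC2 _ (G k) F) //.
- rewrite -EFinB /F /G -raddfB -sumrB; congr (complex.Re _)%:E.
  by apply: eq_bigr => i _; rewrite mulr0 cexp0 mulrBr.
- exact: continuous_subspaceT.
- split=> [x _||]; first by have [] := dG (fun i => k i / m i) x.
  + exact: cvg_at_right_filter (cG _ _).
  + exact: cvg_at_left_filter (cG _ _).
- move=> x _; rewrite derive1E (@derive_val _ _ _ _ _ _ _ (dG _ x)).
  by congr (G _ x); apply/funext => i; rewrite divfK.
Qed.

Lemma frobenius_sqr m n (A : 'M[R[i]]_(m, n)) :
  real_complex R (frobenius A ^+ 2) = \tr (A *m A ^t*).
Proof.
rewrite sqr_sqrtr; last first.
  apply: sumr_ge0 => i _; apply: sumr_ge0 => j _.
  by have := exprn_ge0 2 (normr_ge0 (A i j)); rewrite lecE => /andP[].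
rewrite rmorph_sum; apply: eq_bigr => i _.
rewrite rmorph_sum mxE; apply: eq_bigr => j _.
transitivity (`|A i j| ^+ 2); last by rewrite normCK !mxE.
by apply: RRe_real; rewrite rpredX ?normr_real.
Qed.

Lemma conj_real_complex t : (real_complex R t)^* = real_complex R t.
Proof. exact: conjc_real. Qed.

End Complex.

(** * Hermitian forms on real vectors, and convexity of real quadratics *)

Section Quadratic.
Variables (R : realType) (n : nat).

Lemma quadratic_form_hermsym (Q : 'M[R[i]]_n) (b : 'cV[R]_n) :
  Q \is hermsymmx ->
  ((map_mx (real_complex R) b)^T *m Q *m map_mx (real_complex R) b) 0 0 =
  real_complex R ((b^T *m map_mx (@complex.Re R) Q *m b) 0 0).
Proof.
move=> /is_hermitianmxP; rewrite expr0 scale1r => QE.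
set z := LHS.
(* Conjugation fixes the real vector and turns [Q] into its transpose. Exchanging the two summation
   indices then gives back [z]. *)
have zr : z \is Num.real.
  apply/CrealP; rewrite /z {2}QE !mxE rmorph_sum; under eq_bigr do
    rewrite !mxE rmorphM rmorph_sum mulr_suml.
  under [RHS]eq_bigr do rewrite !mxE mulr_suml.
  rewrite exchange_big; apply: eq_bigr => i _; apply: eq_bigr => j _.
  rewrite !mxE !rmorphM /= !conj_real_complex.
  by rewrite mulrC mulrA mulrAC.
rewrite -(RRe_real zr); congr (real_complex R _).
rewrite /z !mxE raddf_sum; apply: eq_bigr => i _.
rewrite !mxE !mulr_suml raddf_sum; apply: eq_bigr => j _.
rewrite !mxE /=; case: (Q j i) => x y /=.
by rewrite !(mul0r, mulr0, subr0).
Qed.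

(** The affine part cancels in the gap between chord and function, which equals s (1 - s) (x - y)^T
    P (x - y) exactly. *)
Lemma quadratic_convex (P : 'M[R]_n) (q : 'cV[R]_n) (c : R) :
  (forall b : 'cV[R]_n, 0 <= (b^T *m P *m b) 0 0) ->
  convex_function (setT : set (convex_lmodType 'cV[R]_n)) (quadratic P q c).
Proof.
move=> P0 t x y _ _.
rewrite convRE.
set s : R := t%:num.
have s0 : 0 <= s by exact: (@ge0 R _ t).
have s1 : s <= 1 by exact: (@le1 R _ t).
have -> : conv t x y = s *: (x : 'cV_n) + (1 - s) *: (y : 'cV_n) :> 'cV[R]_n.
  by [].
rewrite -subr_ge0 /unstable.onem.
rewrite [leRHS](_ : _ =
    s * (1 - s) * (((x : 'cV_n) - y)^T *m P *m (x - y)) 0 0).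
  by rewrite mulr_ge0 ?P0 // mulr_ge0 ?subr_ge0.
rewrite /quadratic !linearD /= !linearZ /= !linearN /=.
rewrite !(mulmxDl, mulmxDr, mulmxN, mulNmx, =^~ scalemxAl, =^~ scalemxAr).
rewrite !mxE.
ring.
Qed.

End Quadratic.

(** * [Q_mx] as the Gram matrix of the modal responses over [0, tau] *)

Section Gramian.
Variables (R : realType) (n nu ny : nat).
Variables (lam : 'rV[R[i]]_n) (Phi : 'I_n -> 'M[R[i]]_(ny, nu)) (tau : R).

Lemma mxtrace_mul_conj (A B : 'M[R[i]]_(ny, nu)) :
  (\tr (A *m B ^t*))^* = \tr (B *m A ^t*).
Proof.
rewrite rmorph_sum; apply: eq_bigr => i _; rewrite !mxE rmorph_sum.
by apply: eq_bigr => j _; rewrite !mxE rmorphM /= conjCK mulrC.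
Qed.

(** A single sum over pairs matches the finite index type of [integral_Re_cexp]. *)
Lemma frobenius_sum_sqr (c : 'I_n -> R[i]) :
  real_complex R (frobenius (\sum_i c i *: Phi i) ^+ 2) =
  \sum_ij c ij.1 * (c ij.2)^* * \tr (Phi ij.1 *m Phi ij.2 ^t*).
Proof.
rewrite frobenius_sqr mulmx_suml raddf_sum /=.
rewrite -(pair_big xpredT xpredT (fun i j => c i * (c j)^* *
  \tr (Phi i *m Phi j ^t*))) /=.
apply: eq_bigr => i _.
(* Conjugating the trace brings the second sum to the left factor, where the trace is linear instead
   of conjugate-linear. *)
rewrite -scalemxAl linearZ /= -mxtrace_mul_conj mulmx_suml [\tr _]raddf_sum /=.
rewrite rmorph_sum /= mulr_sumr; apply: eq_bigr => j _.
by rewrite -scalemxAl linearZ rmorphM /= mxtrace_mul_conj mulrA.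
Qed.

(** Exchanging [i] and [j] conjugates the exponent, the trace and the denominator separately. *)
Lemma Q_mx_hermsym : Q_mx lam Phi tau \is hermsymmx.
Proof.
apply/is_hermitianmxP; rewrite expr0 scale1r; apply/matrixP => i j.
rewrite !mxE rmorphM fmorph_div rmorphB rmorph1 /= mxtrace_mul_conj.
rewrite -cexp_conj rmorphM rmorphD rmorphB rmorphN /= !conjCK.
rewrite conj_real_complex.
by rewrite [X in cexp (X * _)]addrC [X in _ / X]addrC.
Qed.

Hypothesis lam_lt0 : forall i, complex.Re (lam 0 i) < 0.
Hypothesis tau_gt0 : 0 < tau.

Lemma integral_frobenius_sqr (b : 'cV[R]_n) :
  (\int[lebesgue_measure]_(t in `[0%R, tau])
     (frobenius (\sum_i cexp (lam 0 i * real_complex R t) *: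
                   (real_complex R (b i 0) *: Phi i)) ^+ 2)%:E)%E =
  ((b^T *m map_mx (@complex.Re R) (Q_mx lam Phi tau) *m b) 0 0)%:E.
Proof.
pose k (ij : 'I_n * 'I_n) : R[i] := real_complex R (b ij.1 0 * b ij.2 0) *
  \tr (Phi ij.1 *m Phi ij.2 ^t*).
pose m (ij : 'I_n * 'I_n) : R[i] := lam 0 ij.1 + (lam 0 ij.2)^*.
(* Each exponent is a sum of two numbers with negative real part. *)
have m0 ij : m ij != 0.
  rewrite eq_complex negb_and; apply/orP; left.
  rewrite /m raddfD /= (_ : complex.Re (_^*) = complex.Re (lam 0 ij.2)).
    by rewrite lt_eqF // -oppr_gt0 opprD addr_gt0 ?oppr_gt0.
  by case: (lam 0 ij.2).
transitivity (\int[lebesgue_measure]_(t in `[0%R, tau])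
    (complex.Re (\sum_ij k ij * cexp (m ij * real_complex R t)))%:E)%E.
  apply: eq_integral => t _; congr _%:E.
  under eq_bigr do rewrite scalerA.
  apply: (etrans (congr1 (@complex.Re R) (frobenius_sum_sqr _))).
  congr complex.Re; apply: eq_bigr => -[i j] _ /=.
  rewrite /k /m /= mulrDl cexpD [real_complex R (_ * _)]rmorphM.
  rewrite [(_ * real_complex R _)^*]rmorphM /= -cexp_conj rmorphM /=.
  rewrite !conj_real_complex.
  ring.
rewrite integral_Re_cexp //; congr _%:E.
have := quadratic_form_hermsym b Q_mx_hermsym.
move=> /(congr1 (@complex.Re R)) /= <-; congr complex.Re.
rewrite mxE; under [RHS]eq_bigr do rewrite mxE mulr_suml.
rewrite exchange_big pair_big; apply: eq_bigr => -[i j] _ /=.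
(* The minus sign in the denominator of [Q_mx] turns the factor e^(m tau) - 1 of the integral into 1
   - e^(m tau). *)
rewrite !mxE /k /m /= rmorphM -opprD invrN.
ring.
Qed.

End Gramian.

(** [eigenvalue] refers to row vectors, so the eigenvector for [lam 0 i] is row [i] of the inverse
    of [X]. It is nonzero because multiplying it by [X] gives a row of the identity. *)
Lemma stable_pole_lt0 (R : realType) n (A : 'M[R]_n) (X : 'M[R[i]]_n) lam i :
  stable A -> diagonalized_by A X lam -> complex.Re (lam 0 i) < 0.
Proof.
move=> sA [Xu AX]; rewrite -ltcR complexRe; apply: sA.
apply/eigenvalueP; exists (row i (invmx X)).
  rewrite -row_mul (_ : invmx X *m _ = diag_mx lam *m invmx X).
    by apply/rowP => j; rewrite mul_diag_mx !mxE.
  by rewrite -[LHS]mulmx1 -(mulmxV Xu) !mulmxA -(mulmxA (invmx X)) AX mulKmx.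
apply/eqP => r0; have := congr1 (mulmxr X) r0.
rewrite /= -row_mul mulVmx // mul0mx => /rowP /(_ i).
by rewrite !mxE eqxx => /eqP; rewrite oner_eq0.
Qed.

(** Binary vectors are encoded by the finite type of boolean functions, on which a nonempty
    predicate has an arg min. *)
Lemma exists_minimizer_binary (R : realType) n (S : set 'cV[R]_n)
    (f : 'cV[R]_n -> R) :
  (S `<=` @binary R n)%classic -> (exists a, S a) ->
  exists a, minimizer S f a.
Proof.
move=> Sbin [a0 Sa0].
pose v (s : {ffun 'I_n -> bool}) : 'cV[R]_n := \col_i (s i)%:R.
have vK a : S a -> v [ffun i => a i 0 == 1] = a.
  move=> /Sbin ab; apply/colP => i; rewrite !mxE ffunE.
  by move: (ab i); rewrite !inE => /orP[]/eqP ->; rewrite ?eqxx //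
    eq_sym oner_eq0.
have P0 : `[< S (v [ffun i => a0 i 0 == 1]) >] by apply/asboolP; rewrite vK.
have [s /asboolP Ss smin] :=
  arg_minP (P := fun s => `[< S (v s) >]) (f \o v) P0.
exists (v s); split=> // a Sa.
by rewrite -(vK _ Sa); apply: smin; apply/asboolP; rewrite vK.
Qed.

Lemma modal_constraints_affine (R : realType) n nc r (M : 'M[R]_(nc, n)) :
  modal_constraints r M =
  [set a | binary a /\
    col_mx (ones R n)^T M *m a = col_mx (r%:R%:M : 'M[R]_1) 0]%classic.
Proof.
apply/seteqP; split=> a /= [ab].
  by move=> ar aM; split=> //; rewrite mul_col_mx ar aM.
by rewrite mul_col_mx => /eq_col_mx[].
Qed.

(** * Truncation error against binary objective *)

Section Truncation.
Variables (R : realType) (n nu ny : nat).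
Variables (lam : 'rV[R[i]]_n) (Phi : 'I_n -> 'M[R[i]]_(ny, nu)).
Variables (D : 'M[R]_(ny, nu)) (tau : R).
Hypothesis lam_lt0 : forall i, complex.Re (lam 0 i) < 0.
Hypothesis tau_gt0 : 0 < tau.

Let P := map_mx (@complex.Re R) (Q_mx lam Phi tau).
Let J (a : 'cV[R]_n) : R := ((ones R n - a)^T *m P *m (ones R n - a)) 0 0.

Lemma Q_mx_form_ge0 (b : 'cV[R]_n) : 0 <= (b^T *m P *m b) 0 0.
Proof.
rewrite -lee_fin -(integral_frobenius_sqr Phi lam_lt0 tau_gt0).
by apply: integral_ge0 => t _; rewrite lee_fin sqr_ge0.
Qed.

Lemma binary_objectiveE a :
  binary_objective (Q_mx lam Phi tau) a = real_complex R (J a).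
Proof. exact/quadratic_form_hermsym/Q_mx_hermsym. Qed.

Lemma truncation_errorE a :
  truncation_error lam (PoleResidue Phi D) tau (a, D) = sqrte (J a)%:E.
Proof.
rewrite /truncation_error /h2_norm [dirac_part _]/= subrr eqxx.
congr (sqrte _).
apply: etrans (integral_frobenius_sqr Phi lam_lt0 tau_gt0 (ones R n - a)).
apply: eq_integral => t _; congr ((frobenius _) ^+ 2)%:E.
apply: eq_bigr => i _; rewrite !mxE rmorphB rmorph1 /=.
by rewrite scalerBl scale1r.
Qed.

Lemma truncation_error_improper a Da : Da <> D ->
  truncation_error lam (PoleResidue Phi D) tau (a, Da) = +oo%E.
Proof.
move=> DaD; rewrite /truncation_error /h2_norm /= subr_eq0.
by case: eqP => // /esym.
Qed.

Lemma truncation_error_le a b :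
  (truncation_error lam (PoleResidue Phi D) tau (a, D) <=
   truncation_error lam (PoleResidue Phi D) tau (b, D))%E =
  (binary_objective (Q_mx lam Phi tau) a <=
   binary_objective (Q_mx lam Phi tau) b).
Proof.
rewrite !truncation_errorE !binary_objectiveE lecR.
by rewrite lee_sqrt ?lee_fin ?Q_mx_form_ge0.
Qed.

Lemma binary_objective_quadratic a :
  binary_objective (Q_mx lam Phi tau) a =
  real_complex R (quadratic P (- ((P^T + P) *m ones R n))
    (((ones R n)^T *m P *m ones R n) 0 0) a).
Proof.
rewrite binary_objectiveE; congr (real_complex R _).
rewrite /J /quadratic.
have aPe : (a^T *m P *m ones R n) 0 0 = ((ones R n)^T *m P^T *m a) 0 0.
  by rewrite -[in LHS](trmxK (_ *m _ *m _)) [LHS]mxE !trmx_mul trmxK mulmxA.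
rewrite !linearD /= !linearN /= !trmx_mul !linearD /= trmxK.
rewrite !(mulmxDl, mulmxDr, mulmxN, mulNmx).
have E (x y : 'M[R]_1) : (x + y) 0 0 = x 0 0 + y 0 0 by rewrite mxE.
have N (x : 'M[R]_1) : (- x) 0 0 = - x 0 0 by rewrite mxE.
rewrite !(E, N) aPe.
ring.
Qed.

End Truncation.

Theorem theorem3 (R : realType) (n nu ny nc : nat)
  (A : 'M[R]_n) (B : 'M[R]_(n, nu)) (C : 'M[R]_(ny, n)) (D : 'M[R]_(ny, nu))
  (X : 'M[R[i]]_n) (lam : 'rV[R[i]]_n) (p : 'I_nc -> 'I_n * 'I_n)
  (r : nat) (tau : R) :
  let Phi := residue B C X in
  let H := PoleResidue Phi D in
  let M := pairing_mx R p in
  let Q := Q_mx lam Phi tau in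
  stable A ->
  diagonalized_by A X lam ->
  conjugate_pairing lam Phi p ->
  (0 < r < n)%N ->
  0 < tau ->
  [/\ forall (a : 'cV[R]_n) (Da : 'M[R]_(ny, nu)),
        minimizer (truncation_feasible r M) (truncation_error lam H tau)
          (a, Da) ->
        Da = D /\ minimizer (modal_constraints r M) (binary_objective Q) a,
      (exists a, modal_constraints r M a) ->
        exists x, minimizer (truncation_feasible r M)
                    (truncation_error lam H tau) x,
      Q \is hermsymmx
    & convex_quadratic_binary_problem (modal_constraints r M)
        (binary_objective Q)].
Proof.
move=> Phi H M Q sA dA _ _ tau_gt0.
have lam_lt0 i : complex.Re (lam 0 i) < 0 by exact: stable_pole_lt0 dA.
have [P [q [c [QE convP]]]] : exists (P : 'M[R]_n) (q : 'cV[R]_n) (c : R),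
    (forall a, binary_objective Q a = real_complex R (quadratic P q c a)) /\
    convex_function (setT : set (convex_lmodType 'cV[R]_n)) (quadratic P q c).
  eexists _, _, _; split; first by move=> a; exact: binary_objective_quadratic.
  exact/quadratic_convex/Q_mx_form_ge0.
split.
- move=> a Da [/= aS amin].
  have DaD : Da = D.
    apply: contrapT => DaD; have := amin (a, D) aS.
    by rewrite truncation_error_improper // truncation_errorE //.
  split=> //; split=> // b bS.
  rewrite -(truncation_error_le Phi D lam_lt0 tau_gt0).
  rewrite DaD in amin.
  exact: (amin (b, D) bS).
- move=> S0.
  have Sbin : (modal_constraints r M `<=` @binary R n)%classic by move=> a [].
  have [a [aS amin]] := exists_minimizer_binary (quadratic P q c) Sbin S0.
  exists (a, D); split; first exact: aS.
  move=> [b Db] bS; have [->|DbD] := pselect (Db = D).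
    rewrite (truncation_error_le Phi D lam_lt0 tau_gt0).
    rewrite !QE lecR; exact: (amin b bS).
  rewrite [leRHS](truncation_error_improper _ _ _ _ DbD); exact: leey.
- exact: Q_mx_hermsym.
- split.
    exists (1 + nc)%N, (col_mx (ones R n)^T M), (col_mx r%:R%:M 0).
    exact: modal_constraints_affine.
  by exists P, q, c.
Qed.
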